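(* Let $N\ge1$ be an integer. For any $\mu\in M(\mathbb T)$ and all $z\in D$ we have $$h_{N_*\mu}(z^N)=\frac1N\sum_{\zeta^N=1}h_\mu(\zeta z).$$ The measure $\mu$ is $N$-invariant (i.e. $N_*\mu=\mu$) if and only if either of the following functional equations holds on $D$: $$h(z^N)=\frac1N\sum_{\zeta^N=1}h(\zeta z)\quad\text{for }h=h_\mu,$$ and $$f(z^N)^N=\prod_{\zeta^N=1}f(\zeta z)\quad\text{for }f=f_\mu .$$
   Context: $\mathbb T$ is the unit circle, $D$ the open unit disc. $M(\mathbb T)$ is the space of finite real (signed) Borel measures on $\mathbb T$. $N_*\mu$ is the push-forward of $\mu$ under $\varphi_N(\zeta)=\zeta^N$. The Herglotz transform is $h_\mu(z)=\int_{\mathbb T}\frac{\zeta+z}{\zeta-z}\,d\mu(\zeta)$ for $z\in D$, and $f_\mu=\exp(-h_\mu)$. Sums and products over $\zeta^N=1$ run over the complex $N$-th roots of unity. *)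

(* Defs.v *)
From HB Require Import structures.
From mathcomp Require Import all_boot all_order all_algebra.
From mathcomp Require Import all_classical all_reals all_analysis.
From mathcomp Require Import complex.

Set Implicit Arguments.
Unset Strict Implicit.
Unset Printing Implicit Defensive.

Import Order.TTheory GRing.Theory Num.Theory.
Import numFieldNormedType.Exports.

Local Open Scope classical_set_scope.
Local Open Scope ring_scope.
Local Open Scope complex_scope.

(* R[i] carries the topology of its (R[i]-valued) norm through its numFieldType
   structure, which has to be given explicitly here for it to be found. *)
Definition circle_set (R : realType) : set (R[i] : numFieldType) :=
  [set z | `|z| = 1].
Arguments circle_set : clear implicits.

Definition circle (R : realType) : Type := set_type (circle_set R).

HB.instance Definition _ (R : realType) := Topological.on (circle R).

Section circle_structure.
Variable R : realType.

Lemma circle_one_subproof : (1 : R[i]) \in circle_set R.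
Proof. by rewrite inE /circle_set /= normr1. Qed.

HB.instance Definition _ := isPointed.Build (circle R)
  (exist (fun z => z \in circle_set R) 1 circle_one_subproof).

Definition circle_open : set (set (circle R)) := open.

HB.instance Definition _ := @isMeasurable.Build (sigma_display circle_open)
  (circle R) <<s circle_open >> (@sigma_algebra0 _ setT _)
  (@sigma_algebraC (circle R) _) (@sigma_algebra_bigcup _ setT _).

Lemma circle_pow_subproof (N : nat) (w : circle R) :
  (\val w : R[i]) ^+ N \in circle_set R.
Proof.
rewrite inE /circle_set /= normrX.
by have /set_mem -> := valP w; rewrite expr1n.
Qed.

Definition circle_pow (N : nat) (w : circle R) : circle R :=
  exist (fun z => z \in circle_set R) (\val w ^+ N) (circle_pow_subproof N w).

Lemma expr_continuous (K : numFieldType) (n : nat) :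
  continuous (fun z : K => z ^+ n).
Proof.
move=> z; elim: n => [|n IHn].
  exact: (@cst_continuous K K 1).
rewrite (_ : (fun _ => _) = id \* (fun y : K => y ^+ n)).
  by apply: continuousM IHn; exact: cvg_id.
by apply/funext => y /=; rewrite exprS.
Qed.

Lemma measurable_circle_pow (N : nat) :
  measurable_fun [set: circle R] (circle_pow N).
Proof.
apply: (measurability circle_open) => // _ [_ [A oA <-] <-].
apply: sub_sigma_algebra; rewrite setTI.
exists ((fun z : (R[i] : numFieldType) => z ^+ N) @^-1` A) => //.
apply: open_comp => // z _; exact: expr_continuous.
Qed.

End circle_structure.

Definition pushN (R : realType) (N : nat)
    (mu : {charge set (circle R) -> \bar R}) : set (circle R) -> \bar R :=
  pushforward mu (@circle_pow R N).

Section pushN_charge.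
Variables (R : realType) (N : nat) (mu : {charge set (circle R) -> \bar R}).

Let nu : {charge set (circle R) -> \bar R} :=
  measure_function_pushforward__canonical__charge_Charge mu
    (@measurable_circle_pow R N).

Let pushN0 : pushN N mu set0 = 0%E. Proof. exact: (charge0 nu). Qed.

Let pushN_finite A : measurable A -> pushN N mu A \is a fin_num.
Proof. exact: (@fin_num_measure _ _ _ nu). Qed.

Let pushN_sigma_additive : semi_sigma_additive (pushN N mu).
Proof. exact: (@charge_semi_sigma_additive _ _ _ nu). Qed.

HB.instance Definition _ := isCharge.Build _ _ _ (pushN N mu)
  pushN0 pushN_finite pushN_sigma_additive.

End pushN_charge.

(* A charge is unconstrained outside of the sigma-algebra, whence the
   quantification over measurable sets only. *)
Definition N_invariant (R : realType) (N : nat)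
    (mu : {charge set (circle R) -> \bar R}) : Prop :=
  forall A : set (circle R), measurable A -> pushN N mu A = mu A.

(* The library integrates only against nonnegative measures; the integral
   against a charge is the difference of the integrals against its positive and
   negative variations, which do not depend on the choice of a Hahn
   decomposition. *)
Definition charge_hahn d (T : measurableType d) (R : realType)
    (nu : {charge set T -> \bar R}) :
    {PN : set T * set T | hahn_decomposition nu PN.1 PN.2} :=
  let PQ := cid (Hahn_decomposition nu) in
  let QP := cid (projT2 PQ) in
  exist _ (projT1 PQ, projT1 QP) (projT2 QP).

Definition charge_Rintegral d (T : measurableType d) (R : realType)
    (nu : {charge set T -> \bar R}) (f : T -> R) : R :=
  (\int[jordan_pos (svalP (charge_hahn nu))]_x f x -
   \int[jordan_neg (svalP (charge_hahn nu))]_x f x)%R.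

Definition charge_Cintegral d (T : measurableType d) (R : realType)
    (nu : {charge set T -> \bar R}) (f : T -> R[i]) : R[i] :=
  charge_Rintegral nu (fun x => complex.Re (f x)) +i*
  charge_Rintegral nu (fun x => complex.Im (f x)).

Definition expC (R : realType) (z : R[i]) : R[i] :=
  (expR (complex.Re z))%:C *
  (cos (complex.Im z) +i* sin (complex.Im z)).

Definition herglotz (R : realType) (mu : {charge set (circle R) -> \bar R})
    (z : R[i]) : R[i] :=
  charge_Cintegral mu (fun w : circle R => (\val w + z) / (\val w - z)).

Definition exp_herglotz (R : realType)
    (mu : {charge set (circle R) -> \bar R}) (z : R[i]) : R[i] :=
  expC (- herglotz mu z).

Definition unity_roots (R : realType) (N : nat) : set R[i] :=
  [set w | w ^+ N = 1].
Arguments unity_roots : clear implicits.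

Definition disc (R : realType) : set R[i] := [set z | `|z| < 1].
Arguments disc : clear implicits.

(* Main.v *)
(** Averaging the Herglotz kernel over the rotations of z by the N-th roots of
    unity turns it into the kernel of the pair (w^N, z^N), which is the first
    identity. Since every point of the disc is an N-th power, the converse
    amounts to the injectivity of mu |-> h_mu. If h_mu = h_nu, peeling off the
    Taylor coefficients at 0 shows that mu and nu have the same moments. The
    functions that may be inserted in all the moment integrals without breaking
    their equality form an algebra closed under bounded pointwise limits; it
    contains the coordinates, so the sets whose indicators it contains form a
    sigma-algebra to which all open sets belong. For f = exp (- h), the product
    equation says that N h(z^N) - sum h(zeta z) lies in 2 i pi Z; this continuous
    function vanishes at 0, hence on the whole disc. *)
From HB Require Import structures.
Require Import Defs.
From mathcomp Require Import all_boot all_order all_algebra.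
From mathcomp Require Import all_classical all_reals all_analysis.
From mathcomp Require Import cyclic separable cyclotomic measurable_realfun complex.
From mathcomp Require Import ring lra.
Import Order.TTheory GRing.Theory Num.Theory.
Import numFieldNormedType.Exports.
Local Open Scope classical_set_scope.
Local Open Scope ring_scope.
Local Open Scope complex_scope.

Set Implicit Arguments.
Unset Strict Implicit.
Unset Printing Implicit Defensive.

(** * Bounded measurable functions and integration against finite measures *)

Section bounded_measurable.
Context d (T : measurableType d) (R : realType).
Implicit Types (f g : T -> R) (m : {finite_measure set T -> \bar R}).

Definition bounded_measurable f :=
  measurable_fun [set: T] f /\ exists M, forall x, `|f x| <= M.

Lemma bounded_measurable_integrable m f :
  bounded_measurable f -> m.-integrable [set: T] (EFin \o f).
Proof.
move=> [mf [M fM]]; apply: measurable_bounded_integrable => //.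
  by rewrite ltey_eq fin_num_measure.
exists M; split; first exact: num_real.
by move=> x Mx y _; exact: le_trans (fM y) (ltW Mx).
Qed.

Lemma bounded_measurable_cst (c : R) : bounded_measurable (fun=> c).
Proof. by split; [exact: measurable_cst|exists `|c|]. Qed.

Lemma bounded_measurableD f g : bounded_measurable f -> bounded_measurable g ->
  bounded_measurable (fun x => f x + g x).
Proof.
move=> [mf [M fM]] [mg [K gK]]; split; first exact: measurable_funD.
by exists (M + K) => x; rewrite (le_trans (ler_normD _ _)) // lerD.
Qed.

Lemma bounded_measurableM f g : bounded_measurable f -> bounded_measurable g ->
  bounded_measurable (fun x => f x * g x).
Proof.
move=> [mf [M fM]] [mg [K gK]]; split; first exact: measurable_funM.
by exists (M * K) => x; rewrite normrM ler_pM.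
Qed.

Lemma bounded_measurableZ (c : R) f : bounded_measurable f ->
  bounded_measurable (fun x => c * f x).
Proof. by move=> bf; apply: bounded_measurableM => //; exact: bounded_measurable_cst. Qed.

Lemma bounded_measurableN f : bounded_measurable f ->
  bounded_measurable (fun x => - f x).
Proof.
move=> bf; rewrite (_ : (fun _ => _) = (fun x => -1 * f x)).
  exact: bounded_measurableZ.
by apply/funext => x; rewrite mulN1r.
Qed.

Lemma bounded_measurableB f g : bounded_measurable f -> bounded_measurable g ->
  bounded_measurable (fun x => f x - g x).
Proof. by move=> bf bg; apply: bounded_measurableD => //; exact: bounded_measurableN. Qed.

Lemma bounded_measurableX f (n : nat) : bounded_measurable f ->
  bounded_measurable (fun x => f x ^+ n).
Proof.
move=> bf; elim: n => [|n IHn].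
  by under eq_fun do rewrite expr0; exact: bounded_measurable_cst.
by under eq_fun do rewrite exprS; exact: bounded_measurableM.
Qed.

Lemma bounded_measurableV f (e : R) : 0 < e -> (forall x, e <= f x) ->
  bounded_measurable f -> bounded_measurable (fun x => (f x)^-1).
Proof.
move=> e0 ef [mf _]; split.
  (* On positive values the inverse is the real power of exponent -1, which is measurable. *)
  rewrite (_ : (fun _ => _) = (@powR R ^~ (-1)) \o f).
    by apply: measurableT_comp => //; exact: measurable_powR.
  by apply/funext => x /=; rewrite powR_inv1 // (le_trans _ (ef x)) // ltW.
exists e^-1 => x; have fx : 0 < f x := lt_le_trans e0 (ef x).
by rewrite normfV gtr0_norm // lef_pV2 ?posrE.
Qed.

(** An equality [m1 - m3 = m4 - m2] of signed measures, stated additively so that only nonnegative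
    measures have to be integrated against. *)
Lemma Rintegral_measure_add (m1 m2 m3 m4 : {finite_measure set T -> \bar R}) f :
  bounded_measurable f ->
  (forall A, measurable A -> (m1 A + m2 A = m3 A + m4 A)%E) ->
  \int[m1]_x f x + \int[m2]_x f x = \int[m3]_x f x + \int[m4]_x f x.
Proof.
move=> bf m1234.
have E (m m' : {finite_measure set T -> \bar R}) :
    \int[m]_x f x + \int[m']_x f x = fine (\int[measure_add m m']_x (f x)%:E)%E.
  have im := bounded_measurable_integrable m bf.
  have im' := bounded_measurable_integrable m' bf.
  rewrite (@integral_measure_add _ _ _ m m') //.
  by rewrite fineD //; exact: integrable_fin_num.
rewrite !E; congr fine; apply: eq_measure_integral => A mA _.
by rewrite [LHS]measure_addE [RHS]measure_addE; exact: m1234.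
Qed.

Lemma Rintegral_dominated_cvg m (f_ : nat -> T -> R) f (M : R) :
  (forall n, measurable_fun [set: T] (f_ n)) -> measurable_fun [set: T] f ->
  (forall n x, `|f_ n x| <= M) -> (forall x, f_ n x @[n --> \oo] --> f x) ->
  \int[m]_x f_ n x @[n --> \oo] --> \int[m]_x f x.
Proof.
move=> mf_ mf f_M f_f.
have [] := @dominated_convergence _ _ _ m setT measurableT
  (fun n => EFin \o f_ n) (EFin \o f) (cst M%:E).
- by move=> n; exact/measurable_EFinP.
- exact/measurable_EFinP.
- by apply: aeW => x _; apply/fine_cvgP; split; [exact: nearW|exact: f_f].
- exact/(bounded_measurable_integrable m)/bounded_measurable_cst.
- by apply: aeW => x n _; rewrite lee_fin.
move=> intf _ cvgf.
apply: fine_cvg; rewrite fineK; last exact: integrable_fin_num.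
exact: cvgf.
Qed.

End bounded_measurable.

(** * Integration against a charge *)

Section charge_integral.
Context d (T : measurableType d) (R : realType).
Implicit Types (f g : T -> R) (nu : {charge set T -> \bar R}).

(** The ascribed type records that the Jordan variations are finite measures, so that bounded
    measurable functions are integrable against them. *)
Definition charge_pos nu : {finite_measure set T -> \bar R} :=
  jordan_pos (svalP (charge_hahn nu)).
Definition charge_neg nu : {finite_measure set T -> \bar R} :=
  jordan_neg (svalP (charge_hahn nu)).

Lemma charge_posneg nu A : measurable A ->
  nu A = (charge_pos nu A - charge_neg nu A)%E.
Proof.
move=> mA; rewrite [LHS](jordan_decomp (svalP (charge_hahn nu)) mA).
by rewrite /cadd /= cscaleN1.
Qed.

(** The integral does not depend on how the charge is split: two splittings as a difference give,
    after moving the subtracted measures across, two equal sums of measures. *)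
Lemma charge_RintegralE nu (m1 m2 : {finite_measure set T -> \bar R}) f :
  bounded_measurable f -> (forall A, measurable A -> nu A = (m1 A - m2 A)%E) ->
  charge_Rintegral nu f = \int[m1]_x f x - \int[m2]_x f x.
Proof.
move=> bf nuE; rewrite /charge_Rintegral -/(charge_pos nu) -/(charge_neg nu).
apply/eqP; rewrite subr_eq addrAC eq_sym subr_eq eq_sym; apply/eqP.
apply: Rintegral_measure_add => // A mA.
have := nuE A mA; rewrite charge_posneg //.
have := fin_num_measure (charge_pos nu) A mA.
have := fin_num_measure (charge_neg nu) A mA.
have := fin_num_measure m1 A mA; have := fin_num_measure m2 A mA.
move=> /fineK <- /fineK <- /fineK <- /fineK <-.
by rewrite -!EFinB -!EFinD => -[abce]; congr EFin; lra.
Qed.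

Lemma eq_charge_Rintegral nu nu' f : bounded_measurable f ->
  (forall A, measurable A -> nu A = nu' A) ->
  charge_Rintegral nu f = charge_Rintegral nu' f.
Proof.
move=> bf nunu'; apply: charge_RintegralE => // A mA.
by rewrite nunu' // charge_posneg.
Qed.

Lemma charge_RintegralD nu f g : bounded_measurable f -> bounded_measurable g ->
  charge_Rintegral nu (fun x => f x + g x) =
  charge_Rintegral nu f + charge_Rintegral nu g.
Proof.
move=> bf bg; rewrite /charge_Rintegral -/(charge_pos nu) -/(charge_neg nu).
rewrite !RintegralD //; try exact: bounded_measurable_integrable.
ring.
Qed.

Lemma charge_RintegralZ nu (c : R) f : bounded_measurable f ->
  charge_Rintegral nu (fun x => c * f x) = c * charge_Rintegral nu f.
Proof.
move=> bf; rewrite /charge_Rintegral -/(charge_pos nu) -/(charge_neg nu).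
rewrite !RintegralZl //; try exact: bounded_measurable_integrable.
ring.
Qed.

Lemma charge_Rintegral_cst nu (c : R) :
  charge_Rintegral nu (fun=> c) = c * fine (nu setT).
Proof.
rewrite /charge_Rintegral -/(charge_pos nu) -/(charge_neg nu) !Rintegral_cst //.
rewrite -mulrBr; congr (_ * _); rewrite charge_posneg // fineB //;
  exact: fin_num_measure.
Qed.

Lemma charge_Rintegral_indic nu A : measurable A ->
  charge_Rintegral nu \1_A = fine (nu A).
Proof.
move=> mA; rewrite /charge_Rintegral -/(charge_pos nu) -/(charge_neg nu).
rewrite /Rintegral !integral_indic // !setIT charge_posneg // fineB //;
  exact: fin_num_measure.
Qed.

(** This is the total variation norm of [nu]. *)
Definition charge_mass nu : R :=
  fine (charge_pos nu setT) + fine (charge_neg nu setT).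

Lemma charge_mass_ge0 nu : 0 <= charge_mass nu.
Proof. by rewrite addr_ge0 // fine_ge0. Qed.

Lemma ler_charge_Rintegral nu f (M : R) : bounded_measurable f ->
  (forall x, `|f x| <= M) -> `|charge_Rintegral nu f| <= M * charge_mass nu.
Proof.
move=> bf fM; have le_m (m : {finite_measure set T -> \bar R}) :
    `|\int[m]_x f x| <= M * fine (m setT).
  have iF := bounded_measurable_integrable m bf.
  rewrite -Rintegral_cst // (le_trans (le_normr_Rintegral _ _)) //.
  apply: le_Rintegral => //; first exact: integrable_norm.
  exact/bounded_measurable_integrable/bounded_measurable_cst.
by rewrite /charge_mass mulrDr (le_trans (ler_normB _ _)) // lerD // le_m.
Qed.

Lemma charge_Rintegral_dominated_cvg nu (f_ : nat -> T -> R) f (M : R) :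
  (forall n, measurable_fun [set: T] (f_ n)) -> measurable_fun [set: T] f ->
  (forall n x, `|f_ n x| <= M) -> (forall x, f_ n x @[n --> \oo] --> f x) ->
  charge_Rintegral nu (f_ n) @[n --> \oo] --> charge_Rintegral nu f.
Proof.
by move=> mf_ mf f_M f_f; apply: cvgB; exact: (@Rintegral_dominated_cvg _ _ _ _ _ _ M).
Qed.

End charge_integral.

(** * Change of variables under a push-forward *)

Section pushforward_finite.
Context d d' (T : measurableType d) (T' : measurableType d') (R : realType).
Variables (phi : T -> T') (m : {finite_measure set T -> \bar R}).

(* The measurability proof is an argument so that the finite measure structure
   can be inferred from the term. *)
Definition mpushforward of measurable_fun [set: T] phi := pushforward m phi.

Hypothesis mphi : measurable_fun [set: T] phi.

HB.instance Definition _ := Measure.copy (mpushforward mphi)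
  (measure_function_pushforward__canonical__measure_function_Measure m mphi).

Let mpushforward_finite : fin_num_fun (mpushforward mphi).
Proof.
move=> A mA; apply: fin_num_measure.
by rewrite -[X in measurable X]setTI; exact: mphi.
Qed.

HB.instance Definition _ := @Measure_isFinite.Build _ _ _
  (mpushforward mphi) mpushforward_finite.

Lemma Rintegral_mpushforward (f : T' -> R) : bounded_measurable f ->
  \int[mpushforward mphi]_x f x = \int[m]_x f (phi x).
Proof.
move=> bf; congr fine; apply: (@integral_pushforward _ _ _ _ _ phi mphi m setT) => //.
  by apply/measurable_EFinP; case: bf.
apply: (@bounded_measurable_integrable _ _ _ m (f \o phi)).
case: bf => mf [M fM]; split; first exact: measurableT_comp.
by exists M => x; exact: fM.
Qed.

End pushforward_finite.

(** The images of the two Jordan variations need not be the Jordan variations of the image, since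
    cancellation may occur. They still split it as a difference of finite measures, which is enough
    to compute the integral. *)
Lemma charge_Rintegral_pushforward d d' (T : measurableType d)
    (T' : measurableType d') (R : realType) (phi : T -> T')
    (nu : {charge set T -> \bar R}) (nu' : {charge set T' -> \bar R})
    (f : T' -> R) :
  measurable_fun [set: T] phi -> bounded_measurable f ->
  (forall A, measurable A -> nu' A = pushforward nu phi A) ->
  charge_Rintegral nu' f = charge_Rintegral nu (f \o phi).
Proof.
move=> mphi bf nu'E.
rewrite (charge_RintegralE (m1 := mpushforward (charge_pos nu) mphi)
  (m2 := mpushforward (charge_neg nu) mphi) bf) ?Rintegral_mpushforward //.
move=> A mA; rewrite nu'E // /pushforward charge_posneg //.
by rewrite -[X in measurable X]setTI; exact: mphi.
Qed.

(** * Real and imaginary parts *)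

Section complex_components.
Context {R : realType}.
Implicit Types (x y : R[i]) (r : R).

Lemma ReD x y : complex.Re (x + y) = complex.Re x + complex.Re y.
Proof. by case: x y => [? ?] [? ?]. Qed.

Lemma ImD x y : complex.Im (x + y) = complex.Im x + complex.Im y.
Proof. by case: x y => [? ?] [? ?]. Qed.

Lemma ReN x : complex.Re (- x) = - complex.Re x. Proof. by case: x. Qed.

Lemma ImN x : complex.Im (- x) = - complex.Im x. Proof. by case: x. Qed.

Lemma ReM x y : complex.Re (x * y) =
  complex.Re x * complex.Re y - complex.Im x * complex.Im y.
Proof. by case: x y => [? ?] [? ?]. Qed.

Lemma ImM x y : complex.Im (x * y) =
  complex.Re x * complex.Im y + complex.Im x * complex.Re y.
Proof. by case: x y => [? ?] [? ?]. Qed.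

Lemma ReV x : complex.Re x^-1 =
  complex.Re x * (complex.Re x ^+ 2 + complex.Im x ^+ 2)^-1.
Proof. by case: x. Qed.

Lemma ImV x : complex.Im x^-1 =
  - complex.Im x * (complex.Re x ^+ 2 + complex.Im x ^+ 2)^-1.
Proof. by case: x => a b /=; rewrite mulNr. Qed.

Lemma normC_real r : `|r%:C| = `|r|%:C.
Proof. by rewrite normc_def /= expr0n addr0 sqrtr_sqr. Qed.

Lemma normC_ge_Re x r : `|x| <= r%:C -> `|complex.Re x| <= r.
Proof. by move=> xr; rewrite -lecR (le_trans (normc_ge_Re x)). Qed.

Lemma normC_ge_Im x r : `|x| <= r%:C -> `|complex.Im x| <= r.
Proof.
(* Multiplication by i preserves the norm and turns the imaginary part into a real part, up to
   sign. *)
move=> xr; apply: le_trans (normC_ge_Re (x := x * 'i) (r := r) _).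
  by rewrite ReiNIm normrN.
by rewrite normrM [`|'i%C|]normc_def /= expr0n expr1n add0r sqrtr1 mulr1.
Qed.

Lemma normC_le x r : `|complex.Re x| + `|complex.Im x| <= r -> `|x| <= r%:C.
Proof.
move=> xr; apply: (@le_trans _ _ (`|complex.Re x| + `|complex.Im x|)%:C); last by rewrite lecR.
rewrite {1}(complexE x) (le_trans (ler_normD _ _)) // rmorphD /= lerD ?normC_real //.
by rewrite normrM normC_real [`|'i%C|]normc_def /= expr0n expr1n add0r sqrtr1 mul1r.
Qed.

Lemma normC_ReK x : (complex.Re `|x|)%:C = `|x|.
Proof. by rewrite RRe_real // normr_real. Qed.

End complex_components.

(** * Complex-valued bounded integrands and their integrals *)

Section complex_bounded_measurable.
Context d (T : measurableType d) (R : realType).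
Implicit Types (f g : T -> R[i]) (c : R[i]).

Definition cbounded_measurable f :=
  bounded_measurable (fun x => complex.Re (f x)) /\
  bounded_measurable (fun x => complex.Im (f x)).

Lemma cbounded_measurable_cst c : cbounded_measurable (fun=> c).
Proof. by split; exact: bounded_measurable_cst. Qed.

Lemma cbounded_measurableD f g : cbounded_measurable f ->
  cbounded_measurable g -> cbounded_measurable (fun x => f x + g x).
Proof.
move=> [rf jf] [rg jg]; split.
  by under eq_fun do rewrite ReD; exact: bounded_measurableD.
by under eq_fun do rewrite ImD; exact: bounded_measurableD.
Qed.

Lemma cbounded_measurableM f g : cbounded_measurable f ->
  cbounded_measurable g -> cbounded_measurable (fun x => f x * g x).
Proof.
move=> [rf jf] [rg jg]; split.
  under eq_fun do rewrite ReM.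
  by apply: bounded_measurableB; exact: bounded_measurableM.
under eq_fun do rewrite ImM.
by apply: bounded_measurableD; exact: bounded_measurableM.
Qed.

Lemma cbounded_measurableZ c f : cbounded_measurable f ->
  cbounded_measurable (fun x => c * f x).
Proof. by apply: cbounded_measurableM; exact: cbounded_measurable_cst. Qed.

Lemma cbounded_measurableB f g : cbounded_measurable f ->
  cbounded_measurable g -> cbounded_measurable (fun x => f x - g x).
Proof.
move=> bf bg; under eq_fun => x do rewrite -[- g x]mulN1r.
by apply: cbounded_measurableD => //; exact: cbounded_measurableZ.
Qed.

Lemma cbounded_measurableX f (n : nat) : cbounded_measurable f ->
  cbounded_measurable (fun x => f x ^+ n).
Proof.
move=> bf; elim: n => [|n IHn].
  by under eq_fun do rewrite expr0; exact: cbounded_measurable_cst.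
by under eq_fun do rewrite exprS; exact: cbounded_measurableM.
Qed.

Lemma cbounded_measurableV f (e : R) : 0 < e -> (forall x, e%:C <= `|f x|) ->
  cbounded_measurable f -> cbounded_measurable (fun x => (f x)^-1).
Proof.
move=> e0 ef [rf jf].
have bV : bounded_measurable
    (fun x => (complex.Re (f x) ^+ 2 + complex.Im (f x) ^+ 2)^-1).
  apply: (bounded_measurableV (e := e ^+ 2)); first by rewrite exprn_gt0.
    move=> x; rewrite -lecR add_Re2_Im2 rmorphXn /= lerXn2r // nnegrE.
    by rewrite ler0c ltW.
  by apply: bounded_measurableD; exact: bounded_measurableX.
split.
  by under eq_fun do rewrite ReV; exact: bounded_measurableM.
under eq_fun do rewrite ImV.
by apply: bounded_measurableM => //; exact: bounded_measurableN.
Qed.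

Lemma cbounded_measurable_sum (I : Type) (s : seq I) (F : I -> T -> R[i]) :
  (forall i, cbounded_measurable (F i)) ->
  cbounded_measurable (fun x => \sum_(i <- s) F i x).
Proof.
move=> bF; elim: s => [|i s IHs].
  by under eq_fun do rewrite big_nil; exact: cbounded_measurable_cst.
by under eq_fun do rewrite big_cons; exact: cbounded_measurableD.
Qed.

End complex_bounded_measurable.

Section charge_Cintegral.
Context d (T : measurableType d) (R : realType).
Implicit Types (f g : T -> R[i]) (c : R[i]) (nu : {charge set T -> \bar R}).

Lemma charge_CintegralD nu f g : cbounded_measurable f ->
  cbounded_measurable g -> charge_Cintegral nu (fun x => f x + g x) =
  charge_Cintegral nu f + charge_Cintegral nu g.
Proof.
move=> [rf jf] [rg jg]; rewrite /charge_Cintegral.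
under [in LHS](eq_fun) => x do rewrite ReD.
under [X in _ +i* charge_Rintegral _ X = _]eq_fun => x do rewrite ImD.
by rewrite !charge_RintegralD.
Qed.

Lemma charge_CintegralZ nu c f : cbounded_measurable f ->
  charge_Cintegral nu (fun x => c * f x) = c * charge_Cintegral nu f.
Proof.
move=> [rf jf]; rewrite /charge_Cintegral.
under eq_fun => x do rewrite ReM -mulNr.
under [X in _ +i* charge_Rintegral _ X = _]eq_fun => x do rewrite ImM.
rewrite !charge_RintegralD; try exact: bounded_measurableZ.
rewrite !charge_RintegralZ //.
by apply/eqP; rewrite eq_complex ReM ImM /= !eqxx -mulNr eqxx.
Qed.

Lemma charge_CintegralB nu f g : cbounded_measurable f ->
  cbounded_measurable g -> charge_Cintegral nu (fun x => f x - g x) =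
  charge_Cintegral nu f - charge_Cintegral nu g.
Proof.
move=> bf bg; under eq_fun => x do rewrite -[- g x]mulN1r.
rewrite charge_CintegralD //; last exact: cbounded_measurableZ.
by rewrite charge_CintegralZ // mulN1r.
Qed.

Lemma charge_Cintegral_sum nu (I : Type) (s : seq I) (F : I -> T -> R[i]) :
  (forall i, cbounded_measurable (F i)) ->
  charge_Cintegral nu (fun x => \sum_(i <- s) F i x) =
  \sum_(i <- s) charge_Cintegral nu (F i).
Proof.
move=> bF; elim: s => [|i s IHs].
  under eq_fun do rewrite big_nil; rewrite big_nil.
  by rewrite /charge_Cintegral charge_Rintegral_cst mul0r.
under eq_fun do rewrite big_cons; rewrite big_cons -IHs charge_CintegralD //.
exact: cbounded_measurable_sum.
Qed.

(** The factor 2 comes from bounding the real and the imaginary part separately. *)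
Lemma ler_charge_Cintegral nu f (M : R) : cbounded_measurable f ->
  (forall x, `|f x| <= M%:C) ->
  `|charge_Cintegral nu f| <= (M * charge_mass nu *+ 2)%:C.
Proof.
move=> [rf jf] fM; apply: normC_le; rewrite mulr2n lerD //=.
  by apply: ler_charge_Rintegral => // x; exact: normC_ge_Re.
by apply: ler_charge_Rintegral => // x; exact: normC_ge_Im.
Qed.

Lemma eq_charge_Cintegral nu nu' f : cbounded_measurable f ->
  (forall A, measurable A -> nu A = nu' A) ->
  charge_Cintegral nu f = charge_Cintegral nu' f.
Proof.
by move=> [rf jf] nunu'; congr (_ +i* _); exact: eq_charge_Rintegral.
Qed.

(** The charges are real, so conjugating the integrand conjugates the integral. *)
Lemma charge_Cintegral_conj nu nu' f :
  charge_Cintegral nu f = charge_Cintegral nu' f ->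
  cbounded_measurable f ->
  charge_Cintegral nu (fun x => (f x)^*) = charge_Cintegral nu' (fun x => (f x)^*).
Proof.
move=> [re im] [rf jf].
have ReJ x : complex.Re ((f x)^*)%C = complex.Re (f x) by case: (f x).
have ImJ x : complex.Im ((f x)^*)%C = -1 * complex.Im (f x).
  by case: (f x) => a b; rewrite mulN1r.
rewrite /charge_Cintegral; congr (_ +i* _).
  by under eq_fun do rewrite ReJ.
under eq_fun do rewrite ImJ.
by rewrite !charge_RintegralZ // im.
Qed.

End charge_Cintegral.

(** * Roots of unity and the averaged kernel *)

(** Since [N] is nonzero in the field, ['X^N - 1] is separable and has [N] distinct roots; among
    that many roots of unity one is primitive. *)
Lemma closed_field_prim_root (F : closedFieldType) (N : nat) :
  N%:R != 0 :> F -> {w : F | N.-primitive_root w}.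
Proof.
move=> N0; have N_gt0 : (0 < N)%N by case: N N0 => //; rewrite eqxx.
pose p : {poly F} := 'X^N - 1; have [r Dp] := closed_field_poly_normal p.
apply/sigW; rewrite (monicP _) ?monicXnsubC // scale1r in Dp.
have rn1 : all N.-unity_root r by apply/allP => z; rewrite -root_prod_XsubC -Dp.
have sz_r : (N < (size r).+1)%N.
  by rewrite -(size_prod_XsubC r id) -Dp size_XnsubC.
have [|z] := hasP (has_prim_root N_gt0 rn1 _ sz_r); last by exists z.
by rewrite -separable_prod_XsubC -Dp separable_Xn_sub_1.
Qed.

(** A geometric sum of ratio [w ^+ i], different from 1: multiplied by [w ^+ i - 1] it telescopes to
    [(w ^+ i) ^+ N - 1 = 0]. *)
Lemma sum_prim_rootX (F : fieldType) (N : nat) (w : F) (i : nat) :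
  N.-primitive_root w -> (0 < i < N)%N -> \sum_(k < N) (w ^+ k) ^+ i = 0.
Proof.
move=> wN /andP[i0 iN]; have wi1 : w ^+ i - 1 != 0.
  by rewrite subr_eq0 -(prim_order_dvd wN) gtnNdvd.
apply: (mulfI wi1); rewrite mulr0.
under eq_bigr do rewrite exprAC.
by rewrite -subrX1 exprAC (prim_expr_order wN) expr1n subrr.
Qed.

(** With [u = zeta ^+ k * z], the kernel is [2 * w / (w - u) - 1], and the factorisation of
    [w ^+ N - u ^+ N], where [u ^+ N = z ^+ N], removes [w - u] from the denominator. What is left
    is a polynomial in [zeta ^+ k], and summing over [k] kills its powers of exponent
    [0 < i < N]. *)
Lemma sum_unity_root_kernel (F : fieldType) (N : nat) (zeta w z : F) :
  N.-primitive_root zeta -> w ^+ N != z ^+ N ->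
  \sum_(k < N) (w + zeta ^+ k * z) / (w - zeta ^+ k * z) =
  N%:R * ((w ^+ N + z ^+ N) / (w ^+ N - z ^+ N)).
Proof.
move=> zetaN wz; have D0 : w ^+ N - z ^+ N != 0 by rewrite subr_eq0.
have kernelE (k : 'I_N) : (w + zeta ^+ k * z) / (w - zeta ^+ k * z) =
    (2 / (w ^+ N - z ^+ N)) *
      \sum_(i < N) (w * w ^+ (N.-1 - i) * z ^+ i) * (zeta ^+ k) ^+ i - 1.
  have E := subrXX w (zeta ^+ k * z) N.
  rewrite exprMn exprAC (prim_expr_order zetaN) expr1n mul1r in E.
  have d0 : w - zeta ^+ k * z != 0.
    by apply: contraNneq D0 => d0; rewrite E d0 mul0r.
  under eq_bigr => i _ do rewrite -!mulrA -exprMn [z * _]mulrC.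
  rewrite -mulr_sumr.
  rewrite E in D0 *; have S0 := D0; rewrite mulf_eq0 negb_or d0 /= in S0.
  by field; rewrite d0 S0.
rewrite (eq_bigr _ (fun k _ => kernelE k)) sumrB -mulr_sumr exchange_big /=.
have N_gt0 := prim_order_gt0 zetaN.
(* Only the term [i = 0] survives the summation over [k]. *)
rewrite (bigD1 (Ordinal N_gt0)) //= [X in _ * (_ + X)]big1 => [|i i0]; last first.
  rewrite -mulr_sumr sum_prim_rootX ?mulr0 // ltn_ord andbT lt0n.
  by apply: contraNneq i0 => i0; apply/eqP/val_inj.
rewrite addr0 !sumr_const card_ord.
under eq_bigr do rewrite /= !mulr1.
rewrite sumr_const card_ord subn0 -exprS prednK // -mulr_natl.
by field.
Qed.

(** Passes from the set of all N-th roots of unity to the powers of one primitive root, which list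
    it without repetition. *)
Lemma big_unity_roots (R : realType) (N : nat) (zeta : R[i]) (T : Type)
    (idx : T) (op : Monoid.com_law idx) (F : R[i] -> T) :
  N.-primitive_root zeta ->
  \big[op/idx]_(w \in unity_roots R N) F w = \big[op/idx]_(k < N) F (zeta ^+ k).
Proof.
move=> zetaN; have N_gt0 := prim_order_gt0 zetaN.
have uniq_s : uniq [seq zeta ^+ k | k <- iota 0 N].
  rewrite map_inj_in_uniq ?iota_uniq // => i j.
  rewrite !mem_iota !add0n /= => iN jN /eqP.
  by rewrite (eq_prim_root_expr zetaN) !modn_small // => /eqP.
rewrite (_ : unity_roots R N = [set` [seq zeta ^+ k | k <- iota 0 N]]).
  by rewrite -fsbig_seq // big_map -(big_mkord xpredT (fun k => F (zeta ^+ k)))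
    /index_iota subn0.
apply/seteqP; split => [w /= wN1|w /= /mapP[k _ ->]]; last first.
  by rewrite /unity_roots /= exprAC (prim_expr_order zetaN) expr1n.
have [k ->] := prim_rootP zetaN wN1.
by rewrite map_f // mem_iota add0n ltn_ord.
Qed.

(** * Measurability on the circle and continuity of the Herglotz transform *)

Lemma epsilon_delta_continuous (K L : numFieldType) (f : K -> L) (z : K) :
  (forall e, 0 < e -> exists2 r, 0 < r &
    forall y, `|z - y| < r -> `|f z - f y| < e) ->
  {for z, continuous f}.
Proof.
move=> fP; apply/(@cvgrPdist_lt _ _ _ _ (nbhs_filter z)) => e /fP[r r0 zyr].
near=> y; apply: zyr.
by near: y; exact: cvgr_dist_lt.
Unshelve. all: by end_near. Qed.

Section circle_measurability.
Context {R : realType}.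
Local Notation C := (complex_complex__canonical__Num_NumField R).
Implicit Types (w : circle R) (z : R[i]).

Lemma norm_circle w : `|\val w : R[i]| = 1.
Proof. by have /set_mem := valP w. Qed.

Lemma circle_neq0 w : (\val w : R[i]) != 0.
Proof. by rewrite -normr_eq0 norm_circle oner_eq0. Qed.

Lemma circle_conj w : ((\val w : R[i])^*)%C = (\val w)^-1.
Proof. by rewrite invc_norm norm_circle expr1n invr1 mul1r. Qed.

Lemma Re_continuous : continuous (@complex.Re R : C -> R).
Proof.
move=> z; apply: epsilon_delta_continuous => e e0; exists e%:C; first by rewrite ltcR.
by move=> y zye; rewrite -ReN -ReD -ltcR (le_lt_trans (normc_ge_Re _)).
Qed.

Lemma Im_continuous : continuous (@complex.Im R : C -> R).
Proof.
move=> z; apply: epsilon_delta_continuous => e e0; exists e%:C; first by rewrite ltcR.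
move=> y zye; rewrite -[complex.Im z]opprK -[complex.Im y]opprK -!ReiNIm.
rewrite -opprD normrN -ReN -ReD -mulNr -mulrDl -ltcR (le_lt_trans (normc_ge_Re _)) //.
by rewrite normrM [`|'i%C|]normc_def /= expr0n expr1n add0r sqrtr1 mulr1.
Qed.

(** Open intervals generate the Borel sets of the line, and their preimages are open in the
    circle. *)
Lemma measurable_circle (f : R[i] -> R) :
  continuous (f : C -> R) ->
  measurable_fun [set: circle R] (fun w => f (\val w)).
Proof.
move=> cf; apply: (measurability _ (RGenOpens.measurableE R)) => //.
move=> _ [_ [a [b ->]] <-].
apply: sub_sigma_algebra; rewrite setTI; exists (f @^-1` `]a, b[) => //.
by apply: open_comp => [z _|]; [exact: cf|exact: interval_open].
Qed.

Lemma cbounded_measurable_circle :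
  cbounded_measurable (fun w : circle R => \val w : R[i]).
Proof.
split; split; first exact: measurable_circle Re_continuous.
- by exists 1 => w; apply: normC_ge_Re; rewrite norm_circle.
- exact: measurable_circle Im_continuous.
- by exists 1 => w; apply: normC_ge_Im; rewrite norm_circle.
Qed.

Lemma circle_sub_ge w z (r : R) : `|z| <= r%:C -> (1 - r)%:C <= `|\val w - z|.
Proof.
move=> zr; rewrite rmorphB rmorph1 lerBlDr -(norm_circle w).
rewrite (le_trans _ (lerD (lexx _) zr)) //.
by rewrite -{1}[\val w](subrK z) ler_normD.
Qed.

Lemma disc_bound z : disc R z -> exists2 r : R, r < 1 & `|z| = r%:C.
Proof.
move=> z1; exists (complex.Re `|z|); last by rewrite normC_ReK.
by rewrite -ltcR normC_ReK.
Qed.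

Lemma circle_sub_neq0 w z : disc R z -> \val w - z != 0.
Proof.
move=> /disc_bound[r r1 zr]; rewrite -normr_gt0.
by rewrite (lt_le_trans _ (circle_sub_ge w (r := r) _)) ?zr // ltcR subr_gt0.
Qed.

Lemma cbounded_measurable_subV z : disc R z ->
  cbounded_measurable (fun w : circle R => (\val w - z)^-1).
Proof.
move=> /disc_bound[r r1 zr].
apply: (@cbounded_measurableV _ _ _ _ (1 - r)); first by rewrite subr_gt0.
  by move=> w; apply: circle_sub_ge; rewrite zr.
apply: cbounded_measurableB; first exact: cbounded_measurable_circle.
exact: cbounded_measurable_cst.
Qed.

Lemma cbounded_measurable_herglotz z : disc R z ->
  cbounded_measurable (fun w : circle R => (\val w + z) / (\val w - z)).
Proof.
move=> z1; apply: cbounded_measurableM; last exact: cbounded_measurable_subV.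
apply: cbounded_measurableD; first exact: cbounded_measurable_circle.
exact: cbounded_measurable_cst.
Qed.

(** The difference of the kernels at [z] and [z'] is [2 * w * (z - z') / ((w - z) * (w - z'))], and
    both factors of the denominator have norm at least [1 - r]. *)
Lemma herglotz_lipschitz (mu : {charge set (circle R) -> \bar R}) (r : R) z z' :
  r < 1 -> `|z| <= r%:C -> `|z'| <= r%:C ->
  `|herglotz mu z - herglotz mu z'| <=
    (2 * (1 - r) ^- 2 * charge_mass mu *+ 2)%:C * `|z - z'|.
Proof.
move=> r1 zr z'r.
have z1 : disc R z by rewrite /disc /= (le_lt_trans zr) // ltcR.
have z'1 : disc R z' by rewrite /disc /= (le_lt_trans z'r) // ltcR.
rewrite /herglotz -charge_CintegralB; try exact: cbounded_measurable_herglotz.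
rewrite -[`|z - z'|]normC_ReK -rmorphM.
rewrite (_ : _ * complex.Re _ = (2 * (1 - r) ^- 2 * complex.Re `|z - z'|) *
  charge_mass mu *+ 2); last by rewrite !mulr2n; ring.
apply: ler_charge_Cintegral => [|w].
  by apply: cbounded_measurableB; exact: cbounded_measurable_herglotz.
have d0 := circle_sub_neq0 w z1; have d0' := circle_sub_neq0 w z'1.
rewrite (_ : _ - _ = 2 * \val w * (z - z') * ((\val w - z)^-1 * (\val w - z')^-1));
  last by field; rewrite d0 d0'.
have dV y : `|y| <= r%:C -> `|(\val w - y)^-1| <= ((1 - r)^-1)%:C.
  move=> yr; rewrite normfV fmorphV /= lef_pV2 ?circle_sub_ge // posrE.
    by rewrite (lt_le_trans _ (circle_sub_ge w yr)) // ltcR subr_gt0.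
  by rewrite ltcR subr_gt0.
have -> : (2 * (1 - r) ^- 2 * complex.Re `|z - z'|)%:C =
    2 * `|z - z'| * (((1 - r)^-1)%:C * ((1 - r)^-1)%:C).
  rewrite -[X in _ = _ * X * _]normC_ReK -(rmorph_nat (real_complex R)) -!rmorphM.
  by congr _%:C; rewrite -exprVn; ring.
rewrite !normrM norm_circle mulr1 normr_nat.
by apply: ler_wpM2l; [rewrite mulr_ge0|rewrite ler_pM ?dV].
Qed.

Lemma herglotz_continuous (mu : {charge set (circle R) -> \bar R}) z :
  disc R z -> {for z, continuous (herglotz mu : C ->
    C)}.
Proof.
move=> z1; have [r r1 zr] := disc_bound z1.
(* The Lipschitz bound is used on the disc of radius [s], halfway between [r] and 1, which is a
   neighbourhood of [z]. *)
pose s := (1 + r) / 2; have s1 : s < 1 by rewrite /s; lra.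
have rs : r < s by rewrite /s; lra.
pose K := 2 * (1 - s) ^- 2 * charge_mass mu *+ 2.
have K0 : 0 <= K.
  rewrite mulrn_wge0 // mulr_ge0 ?charge_mass_ge0 // mulr_ge0 // invr_ge0.
  by rewrite exprn_ge0 // subr_ge0 ltW.
(* [K] vanishes when the charge has mass 0; adding 1 makes it a legitimate divisor. *)
have K1 : 0 < (K + 1)%:C by rewrite ltcR ltr_wpDl.
apply: epsilon_delta_continuous => e e0.
have eE : (complex.Re e)%:C = e by rewrite RRe_real // gtr0_real.
exists (Num.min (s - r) (complex.Re e / (K + 1)))%:C => [|y].
  by rewrite ltcR lt_min subr_gt0 rs divr_gt0 // -ltcR // eE.
rewrite -(normC_ReK (z - y)) ltcR lt_min -!ltcR normC_ReK rmorphM fmorphV /= eE.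
move=> /andP[zys zye].
have ys : `|y| <= s%:C.
  rewrite -[y](subrK z) (le_trans (ler_normD _ _)) // zr -lerBrDr -rmorphB /=.
  by rewrite distrC ltW.
apply: le_lt_trans (herglotz_lipschitz mu s1 _ ys) _.
  by rewrite zr lecR ltW.
apply: (@le_lt_trans _ _ ((K + 1)%:C * `|z - y|)).
  by rewrite ler_wpM2r // lecR lerDl.
by rewrite mulrC -ltr_pdivlMr.
Qed.

End circle_measurability.

(** * Polynomial approximation of a step function *)

Section threshold.
Context {R : realType}.
Implicit Types (x s t : R) (m n : nat).

Lemma bernoulli_ge x m : 0 <= x <= 1 -> 1 - m%:R * x <= (1 - x) ^+ m.
Proof.
move=> /andP[x0 x1]; elim: m => [|m IHm]; first by rewrite mul0r subr0 expr0.
rewrite exprS; apply: le_trans (_ : (1 - x) * (1 - m%:R * x) <= _).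
  have : 0 <= m%:R * x * x by rewrite !mulr_ge0.
  by rewrite -natr1; lra.
by rewrite ler_wpM2l // subr_ge0.
Qed.

(** The left-hand side does not increase with [m], because
    [(1 - x) * (1 + (m + 1) * x) <= 1 + m * x]. *)
Lemma bernoulli_le x m : 0 <= x <= 1 -> (1 - x) ^+ m * (1 + m%:R * x) <= 1.
Proof.
move=> /andP[x0 x1]; elim: m => [|m IHm]; first by rewrite expr0 mul0r addr0 mulr1.
apply: le_trans IHm; rewrite exprSr -mulrA ler_wpM2l ?exprn_ge0 ?subr_ge0 //.
have : 0 <= m%:R * x * x by rewrite !mulr_ge0.
have : 0 <= x * x by rewrite mulr_ge0.
by rewrite -natr1; lra.
Qed.

(** With [r] the square root of [s], [n * r ^+ n] is at most the geometric sum of the [r ^+ k] for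
    [k < n], hence at most [1 / (1 - r)]. The other factor [r ^+ n] forces the limit. *)
Lemma natmul_expr_cvg0 s : 0 <= s < 1 -> (n%:R * s ^+ n) @[n --> \oo] --> 0.
Proof.
move=> /andP[s0 s1]; pose r := Num.sqrt s.
have r0 : 0 <= r := sqrtr_ge0 s.
have r1 : r < 1 by rewrite -sqrtr1 ltr_sqrt.
have r1' : 0 <= 1 - r by rewrite subr_ge0 ltW.
have sE : s = r * r by rewrite -expr2 sqr_sqrtr.
have nr n : n%:R * r ^+ n <= (1 - r)^-1.
  rewrite -[leRHS]mul1r ler_pdivlMr ?subr_gt0 //.
  apply: le_trans (_ : (\sum_(k < n) r ^+ k) * (1 - r) <= _).
    rewrite ler_wpM2r // mulr_natl -[X in _ *+ X]subn0.
    rewrite -sumr_const_nat big_mkord ler_sum // => k _.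
    by rewrite ler_wiXn2l ?(ltW r1) // ltnW.
  have := subrX1 r n; rewrite mulrC; have : 0 <= r ^+ n by rewrite exprn_ge0.
  nra.
apply: (@squeeze_cvgr _ _ _ _ (cst 0) (geometric (1 - r)^-1 r)).
- apply: nearW => n /=; rewrite mulr_ge0 ?exprn_ge0 //= sE exprMn mulrA.
  by rewrite ler_wpM2r // exprn_ge0.
- exact: cvg_cst.
- by apply: cvg_geometric; rewrite ger0_norm.
Qed.

(* With the exponent 2 ^ n alone, the limit at t = 1/2 would be 1/e. *)
Lemma threshold_cvg t : 0 <= t <= 1 ->
  (1 - t ^+ n) ^+ (n * 2 ^ n) @[n --> \oo] --> ((t < 1 / 2)%R%:R : R).
Proof.
move=> /andP[t0 t1]; have tn n : 0 <= t ^+ n <= 1.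
  by rewrite exprn_ge0 //= exprn_ile1.
have q01 n : 0 <= (1 - t ^+ n) ^+ (n * 2 ^ n) <= 1.
  by have /andP[a b] := tn n; rewrite exprn_ge0 ?exprn_ile1 ?subr_ge0 ?lerBlDr ?lerDl.
have [t2|t2] := ltP t (1 / 2).
  (* Below 1/2, Bernoulli's inequality bounds the power from below by [1 - n * (2 * t) ^+ n], where
     [2 * t < 1]. *)
  apply: (@squeeze_cvgr _ _ _ _ (fun n => 1 - n%:R * (2 * t) ^+ n) (cst 1)).
  - apply: nearW => n /=; have /andP[_ ->] := q01 n; rewrite andbT.
    by rewrite exprMn mulrA -natrX -natrM; exact: bernoulli_ge.
  - rewrite -[X in _ --> X]subr0; apply: cvgB; first exact: cvg_cst.
    by apply: natmul_expr_cvg0; lra.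
  - exact: cvg_cst.
(* From 1/2 on, the power is at most [1 / (1 + n * (2 * t) ^+ n)], where [2 * t >= 1], hence at most
   [1 / (n + 1)]. *)
apply: (@squeeze_cvgr _ _ _ _ (cst 0) (@harmonic R)).
- apply: nearW => n /=; have /andP[-> _] := q01 n.
  rewrite -[leRHS]mul1r ler_pdivlMr //=.
  apply: le_trans (bernoulli_le (n * 2 ^ n) (tn n)).
  rewrite ler_wpM2l ?(andP (q01 n)).1 // -natr1 addrC lerD2l natrM -mulrA.
  rewrite ler_peMr // natrX -exprMn exprn_ege1 //; lra.
- exact: cvg_cst.
- exact: cvg_harmonic.
Qed.

End threshold.

(** * Function algebras closed under bounded limits *)

Section bounded_closed_algebra.
Context d (T : measurableType d) (R : realType).
Implicit Types (M : set (T -> R)) (f g : T -> R).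

Definition bounded_closed_algebra M :=
  [/\ M `<=` @bounded_measurable _ T R,
      forall c, M (fun=> c),
      forall f g, M f -> M g -> M (fun x => f x + g x),
      forall f g, M f -> M g -> M (fun x => f x * g x) &
      forall (f_ : nat -> T -> R) f (K : R), (forall n, M (f_ n)) ->
        (forall n x, `|f_ n x| <= K) -> (forall x, f_ n x @[n --> \oo] --> f x) ->
        M f].

Section theory.
Variable M : set (T -> R).
Hypothesis algM : bounded_closed_algebra M.

Let Mbm f : M f -> bounded_measurable f. Proof. by case: algM => + *; exact. Qed.
Let Mcst c : M (fun=> c). Proof. by case: algM. Qed.
Let MD f g : M f -> M g -> M (fun x => f x + g x).
Proof. by case: algM => _ _ + *; exact. Qed.
Let MM f g : M f -> M g -> M (fun x => f x * g x).
Proof. by case: algM => _ _ _ + *; exact. Qed.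
Let MZ (c : R) f : M f -> M (fun x => c * f x). Proof. exact: MM. Qed.
Let MB f g : M f -> M g -> M (fun x => f x - g x).
Proof.
move=> Mf Mg; under eq_fun => x do rewrite -[- g x]mulN1r.
by apply: MD => //; exact: MZ.
Qed.
Let MX f n : M f -> M (fun x => f x ^+ n).
Proof.
move=> Mf; elim: n => [|n IHn]; first by under eq_fun do rewrite expr0; exact: Mcst.
by under eq_fun do rewrite exprS; exact: MM.
Qed.
Let Mcvg (f_ : nat -> T -> R) f (K : R) : (forall n, M (f_ n)) ->
  (forall n x, `|f_ n x| <= K) -> (forall x, f_ n x @[n --> \oo] --> f x) -> M f.
Proof. by case: algM => _ _ _ _; exact. Qed.

(** An affine change of scale sends the values of [f] into [0, 1] and [a] to 1/2. The threshold
    polynomials of the rescaled function lie in [M], are bounded by 1 and converge to the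
    indicator. *)
Lemma bounded_closed_algebra_lt f (a : R) : M f -> M \1_[set x | f x < a].
Proof.
move=> Mf; have [_ [K fK]] := Mbm Mf.
(* A bound on [f x - a]; the added 1 makes it positive. *)
pose K' := `|K| + `|a| + 1.
have K'0 : 0 < K' by rewrite ltr_wpDl // addr_ge0.
pose t x := 1 / 2 + (2 * K')^-1 * (f x - a).
have t01 x : 0 <= t x <= 1.
  have faK : `|f x - a| <= K'.
    rewrite (le_trans (ler_normB _ _)) // /K'.
    by have := fK x; have := ler_norm K; lra.
  have : `|(2 * K')^-1 * (f x - a)| <= 1 / 2.
    rewrite normrM ger0_norm ?invr_ge0 ?mulr_ge0 ?(ltW K'0) //.
    by rewrite ler_pdivrMl ?mulr_gt0 //; lra.
  by rewrite ler_norml /t => /andP[? ?]; lra.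
have Mt : M t by apply: MD => //; apply: MZ; exact: MB.
apply: (@Mcvg (fun n x => (1 - t x ^+ n) ^+ (n * 2 ^ n)) _ 1).
- by move=> n; apply: MX; apply: MB => //; exact: MX.
- move=> n x; have /andP[t0 t1] := t01 x.
  have t0n : 0 <= t x ^+ n by rewrite exprn_ge0.
  have t1n : t x ^+ n <= 1 by rewrite exprn_ile1.
  by rewrite ger0_norm ?exprn_ge0 ?exprn_ile1 ?subr_ge0 ?lerBlDr ?lerDl.
move=> x; have := threshold_cvg (t01 x).
suff -> : (t x < 1 / 2)%R%:R = \1_[set x | f x < a] x :> R by [].
rewrite indicE; congr (nat_of_bool _)%:R.
rewrite (_ : (t x < 1 / 2) = (f x < a)).
  by apply/idP/idP; rewrite inE.
by rewrite /t gtrDl pmulr_rlt0 ?invr_gt0 ?mulr_gt0 // subr_lt0.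
Qed.

Lemma bounded_closed_algebra_sigma : sigma_algebra setT [set A | M \1_A].
Proof.
split => /=.
- by rewrite indic0; exact: Mcst.
- move=> A MA; rewrite (_ : \1_(setT `\` A) = (fun x => 1 - \1_A x)).
    by apply: MB => //; exact: Mcst.
  apply/funext => x; rewrite !indicE in_setD in_setT /=.
  by case: (x \in A); rewrite ?subrr ?subr0.
(* The indicator of the union is the limit of 1 - prod_(k < n) (1 - 1_(A k)). *)
move=> A MA; pose p n x : R := \prod_(k < n) (1 - \1_(A k) x).
have Mp n : M (p n).
  rewrite /p; elim: n => [|n IHn].
    by under eq_fun do rewrite big_ord0; exact: Mcst.
  under eq_fun do rewrite big_ord_recr /=.
  by apply: MM => //; apply: MB => //; exact: Mcst.
have p01 n x : 0 <= p n x <= 1.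
  by apply/andP; split; [apply: prodr_ge0|apply: prodr_ile1] => k _;
    rewrite indicE; case: (x \in A k); rewrite ?subrr ?subr0 ?lexx ?ler01.
apply: (@Mcvg (fun n x => 1 - p n x) _ 1).
- by move=> n; apply: MB => //; exact: Mcst.
- by move=> n x; have /andP[? ?] := p01 n x; rewrite ger0_norm ?subr_ge0 // lerBlDr lerDl.
(* At each point the sequence is eventually constant: one factor vanishes as soon as some [A k]
   containing [x] is reached, and all factors are 1 if there is none. *)
move=> x; rewrite indicE; apply: cvg_near_cst.
case: (boolP (x \in _)) => [/set_mem[k _ Akx]|xA].
  exists k.+1 => // n /= kn; rewrite /p (bigD1 (Ordinal kn)) //=.
  by rewrite indicE mem_set // subrr mul0r subr0.
apply: nearW => n; rewrite /p big1 ?subrr // => k _.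
rewrite indicE memNset ?subr0 // => Akx.
by move/negP: xA; apply; rewrite inE; exists k.
Qed.

End theory.
End bounded_closed_algebra.

(** * Injectivity of the Herglotz transform *)

Section herglotz_injectivity.
Context {R : realType}.
Variables mu nu : {charge set (circle R) -> \bar R}.
Implicit Types (f g : circle R -> R) (w : circle R) (z : R[i]).

Local Notation same_integral f := (charge_Cintegral mu f = charge_Cintegral nu f).

Let bV : cbounded_measurable (fun w : circle R => (\val w)^-1 : R[i]).
Proof.
rewrite (_ : (fun _ => _) = fun w : circle R => (\val w - 0)^-1).
  by apply: cbounded_measurable_subV; rewrite /disc /= normr0.
by apply/funext => w; rewrite subr0.
Qed.

Let bK (n : nat) z : disc R z ->
  cbounded_measurable (fun w => (\val w)^-1 ^+ n * (\val w / (\val w - z))).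
Proof.
move=> z1; apply: cbounded_measurableM; first exact: cbounded_measurableX.
apply: cbounded_measurableM; last exact: cbounded_measurable_subV.
exact: cbounded_measurable_circle.
Qed.

Let K0 (n : nat) : (fun w : circle R => (\val w)^-1 ^+ n * (\val w / (\val w - 0))) =
  (fun w => (\val w)^-1 ^+ n).
Proof. by apply/funext => w; rewrite subr0 divff ?mulr1 ?circle_neq0. Qed.

Let disc0 : disc R 0. Proof. by rewrite /disc /= normr0. Qed.

(* The kernels converge uniformly, at speed O(z), to w^-n as z tends to 0. *)
Lemma same_integral_kernel0 (n : nat) :
  (forall z, disc R z -> z != 0 ->
     same_integral (fun w => (\val w)^-1 ^+ n * (\val w / (\val w - z)))) ->
  same_integral (fun w => (\val w)^-1 ^+ n : R[i]).
Proof.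
move=> sameK; apply/eqP; rewrite -subr_eq0 -normr_le0.
set delta := _ - _; pose V := (charge_mass mu + charge_mass nu) *+ 2.
have V0 : 0 <= V by rewrite mulrn_wge0 // addr_ge0 ?charge_mass_ge0.
have deltaV (e : R) : 0 < e -> e <= 1 / 2 -> `|delta| <= (2 * e * V)%:C.
  move=> e0 e2; have ze : disc R e%:C.
    by rewrite /disc /= normC_real gtr0_norm // ltcR; lra.
  have ez : e%:C != 0 :> R[i] by rewrite -normr_gt0 normC_real ltcR normr_gt0 gt_eqF.
  have diff_le (m : {charge set (circle R) -> \bar R}) :
      `|charge_Cintegral m (fun w => (\val w)^-1 ^+ n) -
        charge_Cintegral m (fun w => (\val w)^-1 ^+ n * (\val w / (\val w - e%:C)))|
      <= (2 * e * charge_mass m *+ 2)%:C.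
    rewrite -charge_CintegralB; [|exact: cbounded_measurableX|exact: bK].
    apply: ler_charge_Cintegral => [|w].
      by apply: cbounded_measurableB; [exact: cbounded_measurableX|exact: bK].
    have d0 := circle_sub_neq0 w ze.
    (* The norm of this difference is at most [e / (1 - e)], hence at most [2 * e] as
       [e <= 1 / 2]. *)
    rewrite (_ : _ - _ = (\val w)^-1 ^+ n * (- e%:C / (\val w - e%:C))); last first.
      by field.
    rewrite !normrM normrX !normfV norm_circle invr1 expr1n mul1r normrN normC_real.
    rewrite gtr0_norm // ler_pdivrMr ?normr_gt0 //.
    have : (1 - e)%:C <= `|\val w - e%:C|.
      by apply: circle_sub_ge; rewrite normC_real gtr0_norm.
    move=> le1; apply: le_trans (_ : (2 * e)%:C * (1 - e)%:C <= _).
      by rewrite -rmorphM lecR; nra.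
    by rewrite ler_wpM2l // ler0c mulr_ge0 // ltW.
  have -> : (2 * e * V)%:C =
      (2 * e * charge_mass mu *+ 2)%:C + (2 * e * charge_mass nu *+ 2)%:C.
    by rewrite -rmorphD; congr _%:C; rewrite /V !mulr2n; ring.
  apply: le_trans (lerD (diff_le mu) (diff_le nu)); rewrite -sameK // /delta.
  set a := charge_Cintegral mu _; set b := charge_Cintegral nu _.
  set c := charge_Cintegral mu _.
  rewrite (_ : a - b = (a - c) - (b - c)); last by ring.
  exact: ler_normB.
rewrite -normC_ReK lecR leNgt; apply/negP => delta0.
pose r := complex.Re `|delta|.
rewrite -/r in delta0; have Vr : 0 < V + r by rewrite ltr_wpDl.
have W0 : 0 < 4 * (V + r) by rewrite mulr_gt0.
(* For this [e] the bound [2 * e * V] is at most [r / 2], contradicting that [r] is the norm of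
   [delta]. Adding [r] to [V] covers the case [V = 0]. *)
have e0 : 0 < r / (4 * (V + r)) by rewrite divr_gt0.
have e2 : r / (4 * (V + r)) <= 1 / 2.
  by rewrite ler_pdivrMr //; lra.
have := deltaV _ e0 e2; rewrite -normC_ReK lecR -/r; clearbody r V.
have -> : 2 * (r / (4 * (V + r))) * V = r * (V / (V + r)) / 2.
  by field; rewrite gt_eqF.
have : V / (V + r) <= 1 by rewrite ler_pdivrMr // mul1r lerDl ltW.
nra.
Qed.

Hypothesis same_herglotz : forall z, disc R z -> herglotz mu z = herglotz nu z.

(* With K_n(z) = w^(1-n) / (w - z), the induction step is
   K_(n+1)(z) = (K_n(z) - w^-n) / z. *)
Lemma same_integral_kernel (n : nat) z : disc R z ->
  same_integral (fun w => (\val w)^-1 ^+ n * (\val w / (\val w - z))).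
Proof.
elim: n z => [|n IHn] z z1.
  (* [w / (w - z)] is half the sum of the Herglotz kernels at [z] and at 0, the latter being 1. *)
  rewrite (_ : (fun _ => _) = fun w : circle R =>
      2^-1 * ((\val w + z) / (\val w - z)) + 2^-1 * ((\val w + 0) / (\val w - 0))).
    have bh := cbounded_measurable_herglotz.
    rewrite !charge_CintegralD; try by apply: cbounded_measurableZ; exact: bh.
    rewrite !charge_CintegralZ; try exact: bh.
    by rewrite -!/(herglotz _ _) !same_herglotz.
  apply/funext => w; rewrite addr0 subr0 divff ?circle_neq0 //.
  by field; rewrite circle_sub_neq0 ?circle_neq0.
have sameK y : disc R y -> y != 0 ->
    same_integral (fun w => (\val w)^-1 ^+ n.+1 * (\val w / (\val w - y))).
  move=> y1 y0; rewrite (_ : (fun _ => _) = fun w : circle R =>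
      y^-1 * ((\val w)^-1 ^+ n * (\val w / (\val w - y)) - (\val w)^-1 ^+ n)).
    rewrite !charge_CintegralZ; try (apply: cbounded_measurableB;
      [exact: bK|exact: cbounded_measurableX]).
    rewrite !charge_CintegralB; try exact: bK; try exact: cbounded_measurableX.
    by rewrite IHn // -K0 IHn.
  apply/funext => w; have w0 := circle_neq0 w; have d0 := circle_sub_neq0 w y1.
  by rewrite exprS; field; rewrite w0 y0 d0.
have [->|] := eqVneq z 0; last exact: sameK.
by rewrite K0; exact: same_integral_kernel0.
Qed.

Let sameV (n : nat) : same_integral (fun w => (\val w)^-1 ^+ n : R[i]).
Proof. by rewrite -K0; exact: same_integral_kernel. Qed.

(** On the circle only the integer [j - k] counts. Nonpositive exponents are already settled, and
    positive ones follow by conjugation, which inverts [w]. *)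
Lemma same_integral_moment (j k : nat) :
  same_integral (fun w => \val w ^+ j * (\val w)^-1 ^+ k : R[i]).
Proof.
have [jk|kj] := leqP j k.
  rewrite (_ : (fun _ => _) = fun w : circle R => (\val w)^-1 ^+ (k - j)) //.
  apply/funext => w; rewrite -{1}(subnK jk) exprD mulrCA -exprMn.
  by rewrite divff ?circle_neq0 // expr1n mulr1.
rewrite (_ : (fun _ => _) = fun w : circle R => (((\val w)^-1 ^+ (j - k))^*)%C).
  by apply: charge_Cintegral_conj => //; exact: cbounded_measurableX.
apply/funext => w; rewrite rmorphXn /= -circle_conj conjcK circle_conj.
rewrite -{1}(subnK (ltnW kj)) exprD -mulrA -exprMn.
by rewrite divff ?circle_neq0 // expr1n mulr1.
Qed.

(** The densities [f] for which [f mu] and [f nu] have the same Fourier coefficients. Two natural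
    exponents encode an integer one, so that multiplying by [w] or its inverse increments [j] or
    [k]. *)
Definition same_moments : set (circle R -> R) :=
  [set f | bounded_measurable f /\ forall j k : nat,
    same_integral (fun w => (f w)%:C * (\val w ^+ j * (\val w)^-1 ^+ k))].

(** [same_moments] is a vector space with no evident stability under products; its multipliers are
    stable under them by composition. *)
Definition same_moments_multiplier : set (circle R -> R) :=
  [set g | bounded_measurable g /\ forall f, same_moments f ->
    same_moments (fun w => g w * f w)].

Let bmoment (j k : nat) :
  cbounded_measurable (fun w : circle R => \val w ^+ j * (\val w)^-1 ^+ k : R[i]).
Proof.
apply: cbounded_measurableM; last exact: cbounded_measurableX.
exact: cbounded_measurableX cbounded_measurable_circle.
Qed.

Let breal f : bounded_measurable f ->
  cbounded_measurable (fun w : circle R => (f w)%:C).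
Proof. by move=> bf; split => //=; exact: bounded_measurable_cst. Qed.

Let brealM f (j k : nat) : bounded_measurable f ->
  cbounded_measurable (fun w => (f w)%:C * (\val w ^+ j * (\val w)^-1 ^+ k)).
Proof. by move=> bf; apply: cbounded_measurableM; [exact: breal|exact: bmoment]. Qed.

Lemma same_moments1 : same_moments (fun=> 1).
Proof.
split=> [|j k]; first exact: bounded_measurable_cst.
by under eq_fun do rewrite rmorph1 mul1r; exact: same_integral_moment.
Qed.

Lemma same_momentsD f g : same_moments f -> same_moments g ->
  same_moments (fun w => f w + g w).
Proof.
move=> [bf sf] [bg sg]; split=> [|j k]; first exact: bounded_measurableD.
under eq_fun do rewrite rmorphD mulrDl.
by rewrite !charge_CintegralD; try exact: brealM; rewrite sf sg.
Qed.

Lemma same_momentsZ (c : R) f : same_moments f -> same_moments (fun w => c * f w).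
Proof.
move=> [bf sf]; split=> [|j k]; first exact: bounded_measurableZ.
under eq_fun do rewrite rmorphM -mulrA.
by rewrite !charge_CintegralZ; try exact: brealM; rewrite sf.
Qed.

Lemma same_moments_cvg (f_ : nat -> circle R -> R) f (K : R) :
  (forall n, same_moments (f_ n)) -> (forall n w, `|f_ n w| <= K) ->
  (forall w, f_ n w @[n --> \oo] --> f w) -> same_moments f.
Proof.
move=> sf_ f_K f_f.
have bf : bounded_measurable f.
  split; first by apply: (measurable_fun_cvg (h := f_)) => [n|w _ //]; case: (sf_ n) => -[].
  exists K => w; have f_w : `|f_ n w| @[n --> \oo] --> `|f w| by exact: cvg_norm (f_f w).
  rewrite -(cvg_lim _ f_w) //; apply: limr_le; last exact: nearW.
  by apply/cvg_ex; eexists; exact: f_w.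
split=> // j k.
(* Dominated convergence is applied to real integrals; [v] will be the real or the imaginary part of
   a monomial. *)
have lim_same (v : circle R -> R) : bounded_measurable v ->
    (forall n, charge_Rintegral mu (fun w => f_ n w * v w) =
               charge_Rintegral nu (fun w => f_ n w * v w)) ->
    charge_Rintegral mu (fun w => f w * v w) =
    charge_Rintegral nu (fun w => f w * v w).
  move=> bv sv; have [_ [L vL]] := bv.
  have lim (m : {charge set (circle R) -> \bar R}) :
      charge_Rintegral m (fun w => f_ n w * v w) @[n --> \oo] -->
      charge_Rintegral m (fun w => f w * v w).
    apply: (@charge_Rintegral_dominated_cvg _ _ _ _ _ _ (K * L)).
    - by move=> n; have [bf_ _] := sf_ n; case: (bounded_measurableM bf_ bv).
    - by case: (bounded_measurableM bf bv).
    - by move=> n w; rewrite normrM ler_pM.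
    - by move=> w; apply: cvgMl; exact: f_f.
  have := lim mu; rewrite (funext sv) => lim_mu.
  by apply: cvg_unique lim_mu (lim nu); exact: norm_hausdorff.
have ReE (h : circle R -> R) : (fun w => complex.Re ((h w)%:C *
    (\val w ^+ j * (\val w)^-1 ^+ k))) =
    (fun w => h w * complex.Re (\val w ^+ j * (\val w)^-1 ^+ k)).
  by apply/funext => w; rewrite ReM /= mul0r subr0.
have ImE (h : circle R -> R) : (fun w => complex.Im ((h w)%:C *
    (\val w ^+ j * (\val w)^-1 ^+ k))) =
    (fun w => h w * complex.Im (\val w ^+ j * (\val w)^-1 ^+ k)).
  by apply/funext => w; rewrite ImM /= mul0r addr0.
have [bRe bIm] := bmoment j k.
rewrite /charge_Cintegral !ReE !ImE; congr (_ +i* _); apply: lim_same => // n;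
  have [_ /(_ j k)[]] := sf_ n.
  by rewrite !ReE.
by rewrite !ImE.
Qed.

Lemma same_moments_multiplier_algebra :
  bounded_closed_algebra same_moments_multiplier.
Proof.
split.
- by move=> g [].
- by move=> c; split=> [|f]; [exact: bounded_measurable_cst|exact: same_momentsZ].
- move=> g h [bg sg] [bh sh]; split=> [|f sf]; first exact: bounded_measurableD.
  under eq_fun do rewrite mulrDl.
  by apply: same_momentsD; [exact: sg|exact: sh].
- move=> g h [bg sg] [bh sh]; split=> [|f sf]; first exact: bounded_measurableM.
  by under eq_fun do rewrite -mulrA; apply: sg; exact: sh.
move=> g_ g K sg_ g_K g_g.
have sg f : same_moments f -> same_moments (fun w => g w * f w).
  move=> sf; have [[mf [L fL]] _] := sf.
  apply: (@same_moments_cvg (fun n w => g_ n w * f w) _ (K * L)).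
  - by move=> n; have [_] := sg_ n; exact.
  - by move=> n w; rewrite normrM ler_pM.
  - by move=> w; apply: cvgMl; exact: g_g.
(* Applying the multiplier property to the constant 1 shows that the limit [g] is itself bounded and
   measurable. *)
split=> //; have [+ _] := sg _ same_moments1.
by under eq_fun do rewrite mulr1.
Qed.

(** On the circle the real part is [(w + w^-1) / 2], so multiplying by it only shifts the exponents
    of the moments. *)
Lemma same_moments_multiplier_Re :
  same_moments_multiplier (fun w => complex.Re (\val w)).
Proof.
have [bRe _] := @cbounded_measurable_circle R.
split=> // f [bf sf]; split=> [|j k]; first exact: bounded_measurableM.
rewrite (_ : (fun _ => _) = fun w : circle R =>
    2^-1 * ((f w)%:C * (\val w ^+ j.+1 * (\val w)^-1 ^+ k) +
            (f w)%:C * (\val w ^+ j * (\val w)^-1 ^+ k.+1))).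
  rewrite !charge_CintegralZ; try by apply: cbounded_measurableD; exact: brealM.
  by rewrite !charge_CintegralD; try exact: brealM; rewrite !sf.
apply/funext => w; rewrite rmorphM /= ReJ_add circle_conj !exprS /=.
by field; exact: circle_neq0.
Qed.

(** Same shift of exponents, the imaginary part being [(i / 2) * (w^-1 - w)]. *)
Lemma same_moments_multiplier_Im :
  same_moments_multiplier (fun w => complex.Im (\val w)).
Proof.
have [_ bIm] := @cbounded_measurable_circle R.
split=> // f [bf sf]; split=> [|j k]; first exact: bounded_measurableM.
rewrite (_ : (fun _ => _) = fun w : circle R =>
    (2^-1 * 'i%C) * ((f w)%:C * (\val w ^+ j * (\val w)^-1 ^+ k.+1) -
            (f w)%:C * (\val w ^+ j.+1 * (\val w)^-1 ^+ k))).
  rewrite !charge_CintegralZ; try by apply: cbounded_measurableB; exact: brealM.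
  by rewrite !charge_CintegralB; try exact: brealM; rewrite !sf.
apply/funext => w; rewrite rmorphM /= ImJ_sub circle_conj !exprS /=.
by field; exact: circle_neq0.
Qed.

(** An open set is a countable union of traces of discs with rational centre and radius, and each
    trace is a strict sublevel set of a polynomial in the coordinates. *)
Lemma open_circle_multiplier (U : set (circle R)) :
  open U -> same_moments_multiplier \1_U.
Proof.
have dist_lt (a b c r : R) : `|a - c| < r / 2 -> `|b - c| < r ->
    `|a - b| < 3 / 2 * r.
  move=> ac bc; rewrite (le_lt_trans (ler_distD c _ _)) // [`|c - b|]distrC.
  lra.
move=> [B oB <-].
have [_ Mcst MD MM _] := same_moments_multiplier_algebra.
have [M0 _ Mbigcup] := bounded_closed_algebra_sigma same_moments_multiplier_algebra.
pose D (c : rat * rat * rat) : set (circle R) :=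
  [set w | (complex.Re (\val w) - ratr c.1.1) ^+ 2 +
           (complex.Im (\val w) - ratr c.1.2) ^+ 2 < ratr c.2 ^+ 2].
have MDisc c : same_moments_multiplier \1_(D c).
  apply: bounded_closed_algebra_lt same_moments_multiplier_algebra _ _ _.
  have Msqr (f : circle R -> R) a : same_moments_multiplier f ->
      same_moments_multiplier (fun w => (f w - a) ^+ 2).
    by move=> Mf; under eq_fun do rewrite expr2; apply: MM; apply: MD.
  by apply: MD; apply: Msqr;
    [exact: same_moments_multiplier_Re|exact: same_moments_multiplier_Im].
(* Enumerates the rational discs, replacing by the empty set those whose trace is not inside [B]. *)
pose F n := if unpickle n is Some c then
  if `[< D c `<=` \val @^-1` B >] then D c else set0 else set0.
rewrite (_ : \val @^-1` B = \bigcup_n F n).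
  apply: Mbigcup => n; rewrite /F; case: unpickle => [c|]; last exact: M0.
  by case: ifP => _; [exact: MDisc|exact: M0].
apply/seteqP; split=> [w Bw|w [n _]]; last first.
  by rewrite /F; case: unpickle => // c; case: ifPn => // /asboolP; apply.
have : nbhs (\val w : complex_complex__canonical__Num_NumField R) B.
  exact: open_nbhs_nbhs.
move=> /nbhs_ballP[eps /= eps0 epsB].
have epsE : (complex.Re eps)%:C = eps by rewrite RRe_real // gtr0_real.
have r0 : 0 < complex.Re eps by rewrite -ltcR epsE.
(* With a centre within [e / 2] of [w] in each coordinate, a point of the disc of radius [e] is
   within [3 / 2 * e] of [w] in each coordinate, hence at distance less than [3 * e], which is below
   [eps]. *)
have [e /itvP e_in] : exists e, ratr e \in `]0, complex.Re eps / 3[.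
  by apply: rat_in_itvoo; rewrite divr_gt0.
have e0 : 0 < ratr e :> R by rewrite e_in.
have e3 : ratr e < complex.Re eps / 3 by rewrite e_in.
have approx (a : R) : exists p, `|a - ratr p| < ratr e / 2.
  have [|p /itvP p_in] := @rat_in_itvoo R (a - ratr e / 2) (a + ratr e / 2).
    by lra.
  by exists p; rewrite ltr_distlC !p_in.
have [p ap] := approx (complex.Re (\val w)).
have [q aq] := approx (complex.Im (\val w)).
have sqr_lt (a b : R) : 0 <= b -> a ^+ 2 < b ^+ 2 -> `|a| < b.
  by move=> b0; rewrite -(real_normK (num_real a)) ltr_pXn2r // nnegrE.
have [n nE] : exists n, unpickle n = Some (p, q, e).
  by exists (pickle (p, q, e)); exact: pickleK.
exists n; first by [].
rewrite /F nE ifT.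
  rewrite /D /= -(real_normK (num_real (_ - _))) -[X in _ + X](real_normK (num_real _)).
  have := normr_ge0 (complex.Re (\val w) - ratr p).
  have := normr_ge0 (complex.Im (\val w) - ratr q).
  nra.
apply/asboolP => w' Dw' /=; apply: epsB; rewrite -ball_normE /ball_ /=.
have Re' : `|complex.Re (\val w') - ratr p| < ratr e.
  apply: sqr_lt; first exact: ltW.
  apply: le_lt_trans Dw'; rewrite lerDl sqr_ge0 //.
have Im' : `|complex.Im (\val w') - ratr q| < ratr e.
  apply: sqr_lt; first exact: ltW.
  apply: le_lt_trans Dw'; rewrite lerDr sqr_ge0 //.
rewrite -epsE; apply: le_lt_trans (normC_le (lexx _)) _.
rewrite ltcR ReD ImD ReN ImN.
apply: lt_trans (ltrD (dist_lt _ _ _ _ ap Re') (dist_lt _ _ _ _ aq Im')) _.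
lra.
Qed.

(** Once [\1_A] is a multiplier, applying it to the constant 1 and reading the moment with
    [j = k = 0] compares the masses of [A]. *)
Lemma herglotz_inj (A : set (circle R)) : measurable A -> mu A = nu A.
Proof.
move=> mA; suff [_ /(_ _ same_moments1)[_ /(_ 0 0)[reA _]]] :
    same_moments_multiplier \1_A.
  have reE (m : {charge set (circle R) -> \bar R}) :
      charge_Rintegral m (fun w : circle R => complex.Re
        ((\1_A w * 1)%:C * ((\val w) ^+ 0 * (\val w)^-1 ^+ 0))) = fine (m A).
    rewrite -charge_Rintegral_indic //; congr charge_Rintegral.
    by apply/funext => w; rewrite !expr0 !mulr1.
  move: reA; rewrite !reE => fineA.
  by rewrite -(fineK (fin_num_measure mu A mA)) fineA fineK // fin_num_measure.
have sA := bounded_closed_algebra_sigma same_moments_multiplier_algebra.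
by move: A mA; apply: smallest_sub => // U; exact: open_circle_multiplier.
Qed.

End herglotz_injectivity.

Lemma charge_Cintegral_pushN (R : realType) (N : nat)
    (mu : {charge set (circle R) -> \bar R}) (f : circle R -> R[i]) :
  cbounded_measurable f ->
  charge_Cintegral (pushN N mu) f = charge_Cintegral mu (f \o circle_pow N).
Proof.
move=> [rf jf]; congr (_ +i* _);
  exact: charge_Rintegral_pushforward (@measurable_circle_pow R N) _ _.
Qed.

(** * The complex exponential *)

Section complex_exponential.
Context {R : realType}.
Implicit Types a b : R[i].

Lemma expC0 : expC (0 : R[i]) = 1.
Proof. by rewrite /expC /= expR0 cos0 sin0 mul1r. Qed.

Lemma expCD a b : expC (a + b) = expC a * expC b.
Proof.
rewrite /expC ReD ImD expRD cosD sinD rmorphM.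
by rewrite mulrACA; congr (_ * _); simpc; rewrite [X in _ +i* X]addrC.
Qed.

Lemma expC_sum (I : Type) (s : seq I) (F : I -> R[i]) :
  expC (\sum_(i <- s) F i) = \prod_(i <- s) expC (F i).
Proof. by elim/big_ind2: _ => [|a b c e <- <-|]; [exact: expC0|exact: expCD|]. Qed.

Lemma expC_natmul (n : nat) a : expC (n%:R * a) = expC a ^+ n.
Proof.
elim: n => [|n IHn]; first by rewrite mul0r expr0 expC0.
by rewrite -natr1 mulrDl mul1r expCD IHn exprSr.
Qed.

Lemma expC_eqN a b : expC (- a) = expC (- b) <-> expC (a - b) = 1.
Proof.
split=> [ab|ab]; first by rewrite expCD -ab -expCD subrr expC0.
by rewrite -[LHS]mulr1 -ab -expCD; congr expC; ring.
Qed.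

Lemma expC_eq1 a : expC a = 1 -> complex.Re a = 0 /\ sin (complex.Im a) = 0.
Proof.
rewrite /expC => /eqP; simpc; rewrite eq_complex /= => /andP[/eqP ec /eqP es].
have e0 := expR_gt0 (complex.Re a).
have s0 : sin (complex.Im a) = 0.
  by apply/eqP; move/eqP: es; rewrite mulf_eq0 gt_eqF.
split=> //; apply: expR_inj; rewrite expR0 -ec -[LHS]mulr1.
(* A zero of sin has a cosine of absolute value 1, and the real part of the equation, a positive
   number times the cosine, equals 1; so the cosine is 1. *)
have := sin0cos1 s0; move: ec; case: ltrgt0P => // c0 ec c1; rewrite -?c1 //.
- by move: (mulr_gt0 e0 ltr01); nra.
- by rewrite c0 mulr0 in ec; move/eqP: ec; rewrite eq_sym oner_eq0.
Qed.

End complex_exponential.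

(** On the segment from 0 to [z] the function [|Im G|] is continuous, starts at 0 and takes only
    zeros of sin as values, so it cannot leave 0. The real part of [G] vanishes pointwise. *)
Lemma expC_eq1_disc (R : realType) (G : R[i] -> R[i]) :
  (forall z, disc R z -> {for z, continuous
     (G : complex_complex__canonical__Num_NumField R ->
          complex_complex__canonical__Num_NumField R)}) ->
  G 0 = 0 -> (forall z, disc R z -> expC (G z) = 1) ->
  forall z, disc R z -> G z = 0.
Proof.
move=> cG G0 G1 z z1; pose ray (t : R) := t%:C * z.
have ray1 t : 0 <= t <= 1 -> disc R (ray t).
  move=> /andP[t0 t1]; rewrite /disc /= normrM normC_real (ger0_norm t0).
  by apply: le_lt_trans z1; rewrite ler_piMl // lecR.
pose h t := `|complex.Im (G (ray t))|.
have sinh t : 0 <= t <= 1 -> sin (h t) = 0.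
  move=> /ray1/G1/expC_eq1[_]; rewrite /h.
  by case: ger0P => // _; rewrite sinN => ->; rewrite oppr0.
have ch : {within `[0, 1], continuous h}.
  apply: continuous_in_subspaceT => t; rewrite inE /= in_itv /= => t01.
  apply: (@continuous_comp _ _ _ (fun t => complex.Im (G (ray t))) (@Num.norm _ R));
    last exact: norm_continuous.
  apply: (@continuous_comp _ (complex_complex__canonical__Num_NumField R) _
    (G \o ray) (@complex.Im R)); last exact: Im_continuous.
  apply: (@continuous_comp _ (complex_complex__canonical__Num_NumField R)
    (complex_complex__canonical__Num_NumField R) ray G); last exact: cG (ray1 t t01).
  apply: (@epsilon_delta_continuous R (complex_complex__canonical__Num_NumField R)) => e e0.
  have eE : (complex.Re e)%:C = e by rewrite RRe_real // gtr0_real.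
  exists (complex.Re e); first by rewrite -ltcR eE.
  move=> s tse; rewrite /ray -mulrBl -rmorphB normrM normC_real -eE.
  apply: le_lt_trans (_ : `|t - s|%:C * 1 < _); last by rewrite mulr1 ltcR.
  by rewrite ler_wpM2l ?ler0c // ltW.
have zE : z = ray 1 by rewrite /ray mul1r.
have [h1 _] := expC_eq1 (G1 z z1).
apply/eqP; rewrite eq_complex h1 eqxx /= -normr_eq0 {1}zE -/(h 1).
rewrite eq_le normr_ge0 andbT leNgt; apply/negP => h1_gt0.
(* A value reached by the intermediate value theorem, and small enough for its sine to be
   positive. *)
pose v := Num.min (h 1) (pi / 2).
have h0 : h 0 = 0 by rewrite /h /ray mul0r G0 normr0.
have v0 : 0 < v by rewrite lt_min h1_gt0 divr_gt0 // pi_gt0.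
have [t] : exists2 t, t \in `[0, 1] & h t = v.
  apply: IVT => //; rewrite h0 (min_idPl (ltW h1_gt0)) (max_idPr (ltW h1_gt0)).
  by rewrite (ltW v0) ge_min lexx.
rewrite in_itv /= => t01 htv.
have : 0 < sin v.
  apply: sin_gt0_pi; rewrite v0 (@le_lt_trans _ _ (pi / 2)) ?ge_min ?lexx ?orbT //.
  by have := pi_gt0 R; lra.
by rewrite -htv sinh // ltxx.
Qed.

Lemma continuous_sum_ord (K : numFieldType) (F : nat -> K -> K) (n : nat) (z : K) :
  (forall k, {for z, continuous (F k)}) ->
  {for z, continuous (fun y => \sum_(k < n) F k y)}.
Proof.
move=> cF; elim: n => [|n IHn].
  rewrite (_ : (fun _ => _) = cst 0); first exact: cst_continuous.
  by apply/funext => y; rewrite big_ord0.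
rewrite (_ : (fun _ => _) = (fun y => \sum_(k < n) F k y) \+ F n).
  exact: continuousD.
by apply/funext => y; rewrite big_ord_recr.
Qed.

(** * Invariance and the two functional equations *)

Section invariance.
Context {R : realType}.
Variables (N : nat) (zeta : R[i]).
Hypothesis zetaN : N.-primitive_root zeta.
Implicit Types (mu : {charge set (circle R) -> \bar R}) (z : R[i]).

Let N_gt0 : (0 < N)%N := prim_order_gt0 zetaN.

Let N_neq0 : N%:R != 0 :> R[i]. Proof. by rewrite pnatr_eq0 -lt0n. Qed.

Lemma disc_expr z : disc R z -> disc R (z ^+ N).
Proof. by move=> z1; rewrite /disc /= normrX exprn_ilt1 // -lt0n. Qed.

Lemma disc_rotation z (k : nat) : disc R z -> disc R (zeta ^+ k * z).
Proof.
move=> z1; rewrite /disc /= normrM normrX.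
suff -> : `|zeta| = 1 by rewrite expr1n mul1r.
by apply/eqP; rewrite -(pexpr_eq1 N_gt0) // -normrX (prim_expr_order zetaN) normr1.
Qed.

Lemma herglotz_pushN mu z : disc R z ->
  herglotz (pushN N mu) (z ^+ N) =
  N%:R^-1 * \sum_(k < N) herglotz mu (zeta ^+ k * z).
Proof.
move=> z1; have bh (k : nat) :=
  cbounded_measurable_herglotz (disc_rotation k z1).
rewrite /herglotz -charge_Cintegral_sum; last by move=> k; exact: bh.
rewrite -charge_CintegralZ; last by apply: cbounded_measurable_sum => k; exact: bh.
rewrite charge_Cintegral_pushN; last exact: cbounded_measurable_herglotz (disc_expr z1).
congr charge_Cintegral; apply/funext => w /=.
rewrite (sum_unity_root_kernel zetaN) ?mulKf // -subr_eq0.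
exact: (circle_sub_neq0 (circle_pow N w) (disc_expr z1)).
Qed.

Lemma N_invariantP mu : N_invariant N mu <->
  forall z, disc R z -> herglotz mu (z ^+ N) =
    N%:R^-1 * \sum_(k < N) herglotz mu (zeta ^+ k * z).
Proof.
split=> [inv z z1|h_eq].
  rewrite -herglotz_pushN //; apply: eq_charge_Cintegral => [|A mA].
    exact: cbounded_measurable_herglotz (disc_expr z1).
  exact/esym/inv.
move=> A mA; apply: herglotz_inj => // y y1.
(* The hypothesis speaks of N-th powers only, so [y] is replaced by the N-th power of a root [x],
   which lies in the disc as well. *)
have := rootCK N_gt0 y; set x := (N.-root y)%R => <-.
have x1 : disc R x.
  by rewrite /disc /= -(expr_lt1 N_gt0) // -normrX rootCK.
by rewrite herglotz_pushN // h_eq.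
Qed.

Lemma herglotz_defect_continuous mu z : disc R z ->
  {for z, continuous ((fun y => N%:R * herglotz mu (y ^+ N) -
      \sum_(k < N) herglotz mu (zeta ^+ k * y)) :
    complex_complex__canonical__Num_NumField R ->
    complex_complex__canonical__Num_NumField R)}.
Proof.
pose C := complex_complex__canonical__Num_NumField R.
move=> z1; apply: (@cvgB C C C (nbhs (z : C))).
  apply: (@cvgM C C (nbhs (z : C))); first exact: cvg_cst.
  apply: (@continuous_comp C C C (fun y : C => y ^+ N) (herglotz mu)).
    exact: expr_continuous.
  exact: herglotz_continuous (disc_expr z1).
pose F (k : nat) (y : C) : C := herglotz mu (zeta ^+ k * y).
have cF k : F k y @[y --> (z : C)] --> F k z.
  apply: (@continuous_comp C C C (fun y : C => zeta ^+ k * y) (herglotz mu)).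
    by apply: (@cvgM C C (nbhs (z : C))); [exact: cvg_cst|exact: cvg_id].
  exact: herglotz_continuous (disc_rotation k z1).
exact: (@continuous_sum_ord C F N z cF).
Qed.

Lemma exp_herglotzP mu :
  (forall z, disc R z -> herglotz mu (z ^+ N) =
    N%:R^-1 * \sum_(k < N) herglotz mu (zeta ^+ k * z)) <->
  (forall z, disc R z -> exp_herglotz mu (z ^+ N) ^+ N =
    \prod_(k < N) exp_herglotz mu (zeta ^+ k * z)).
Proof.
pose G z := N%:R * herglotz mu (z ^+ N) - \sum_(k < N) herglotz mu (zeta ^+ k * z).
have GP z : herglotz mu (z ^+ N) =
    N%:R^-1 * \sum_(k < N) herglotz mu (zeta ^+ k * z) <-> G z = 0.
  rewrite /G; split=> [->|/eqP]; first by rewrite mulVKf // subrr.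
  by rewrite subr_eq0 => /eqP <-; rewrite mulKf.
(* The N-th power and the product become a multiple and a sum in the exponent, and the quotient of
   the two sides is governed by [G z]. *)
have expGP z : exp_herglotz mu (z ^+ N) ^+ N =
    \prod_(k < N) exp_herglotz mu (zeta ^+ k * z) <-> expC (G z) = 1.
  rewrite /exp_herglotz -expC_natmul mulrN -expC_sum sumrN.
  exact: expC_eqN.
split=> [h_eq z z1|f_eq z z1].
  by apply/expGP; rewrite (GP z).1 ?expC0 //; exact: h_eq.
apply/GP; apply: (@expC_eq1_disc _ G) z z1.
- by move=> z z1; exact: herglotz_defect_continuous.
(* At 0 all [N] rotations coincide with 0, so the sum is [N] times the value there. *)
- rewrite /G expr0n gtn_eqF // (eq_bigr (fun=> herglotz mu 0)) => [|k _].
    by rewrite sumr_const card_ord mulr_natl subrr.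
  by rewrite mulr0.
- by move=> z z1; apply/expGP; exact: f_eq.
Qed.

End invariance.

Unset Implicit Arguments.

Theorem proposition2 (R : realType) (N : nat) (N_ge1 : (1 <= N)%N) :
  (forall (mu : {charge set (circle R) -> \bar R}) (z : R[i]), disc R z ->
     herglotz (pushN N mu) (z ^+ N) =
     N%:R^-1 * \sum_(w \in unity_roots R N) herglotz mu (w * z)) /\
  (forall mu : {charge set (circle R) -> \bar R},
     (N_invariant N mu <->
      forall z : R[i], disc R z ->
        herglotz mu (z ^+ N) =
        N%:R^-1 * \sum_(w \in unity_roots R N) herglotz mu (w * z)) /\
     (N_invariant N mu <->
      forall z : R[i], disc R z ->
        exp_herglotz mu (z ^+ N) ^+ N =
        \big[*%R/1]_(w \in unity_roots R N) exp_herglotz mu (w * z))).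
Proof.
have [zeta zetaN] : {zeta : R[i] | N.-primitive_root zeta}.
  by apply: closed_field_prim_root; rewrite pnatr_eq0 -lt0n.
split=> [mu z z1|mu].
  by rewrite (big_unity_roots _ _ zetaN); exact: herglotz_pushN.
have sumE z := big_unity_roots +%R (fun w => herglotz mu (w * z)) zetaN.
have prodE z := big_unity_roots *%R (fun w => exp_herglotz mu (w * z)) zetaN.
have hP := N_invariantP zetaN mu; have fP := exp_herglotzP zetaN mu.
split.
  by apply: (iff_trans hP); split=> h z z1; have := h z z1; rewrite sumE.
apply: (iff_trans hP); apply: (iff_trans fP).
by split=> f z z1; have := f z z1; rewrite prodE.
Qed.
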